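(* Let $P\subset\mathbb{R}^d$ be a lattice polytope (vertices in $\mathbb{Z}^d$) containing the origin in its interior. Then $$E(P^\vee;t)=\frac{1}{1-t}\,K_P(1/t;1,1,\ldots,1).$$
   Context: The polar dual polytope is $P^\vee=\{\mathbf{v}\in(\mathbb{R}^d)^*: \mathbf{v}(\mathbf{x})\ge -1\ \forall\mathbf{x}\in P\}$, a rational polytope with respect to the dual lattice $(\mathbb{Z}^d)^\vee\cong\mathbb{Z}^d$. For a rational polytope $Q$, the Ehrhart function is $L(Q;m)=|mQ\cap\mathbb{Z}^d|$ and the Ehrhart series is $E(Q;t)=1+\sum_{m\ge1}L(Q;m)t^m$. With $h_P(\mathbf{v})=-\min_{\mathbf{x}\in P}\mathbf{v}(\mathbf{x})$, the dual lattice function of $P$ in the variables $y_0$ and $\mathbf{y}=(y_1,\ldots,y_d)$, $y_i=y_0^{z_i}$, is $$K_P(y_0;\mathbf{y})=\sum_{\mathbf{v}\in(\mathbb{Z}^d)^\vee}y_0^{-h_P(\mathbf{v})}\mathbf{y}^{-\mathbf{v}},$$ which converges for $y_0>1$ and $\mathbf{z}$ in the interior of $P$, and represents a rational function of $y_0,y_1,\ldots,y_d$. Setting $y_0=1/t$, $y_1=\cdots=y_d=1$ corresponds to $\mathbf{z}=0$; the identity is one of power series in $t$ (equivalently, of functions for $0<t<1$, or of rational functions in $t$). *)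

(* Defs.v *)
From HB Require Import structures.
From mathcomp Require Import all_boot all_order all_algebra.
From mathcomp Require Import all_classical all_reals all_analysis.
Set Implicit Arguments.
Unset Strict Implicit.
Unset Printing Implicit Defensive.
Import Order.TTheory GRing.Theory Num.Theory.
Import numFieldNormedType.Exports.
Local Open Scope classical_set_scope.
Local Open Scope ring_scope.

(* Points of R^d are column vectors 'cV[R]_d.  Elements of the dual space are
   row vectors 'rV[R]_d, acting on points by the matrix product; the dual
   lattice is then 'rV[int]_d. *)
Definition pairing (R : realType) (d : nat) (v : 'rV[R]_d) (x : 'cV[R]_d) : R :=
  (v *m x) 0 0.

Definition conv_hull (R : realType) (d n : nat) (p : 'I_n -> 'cV[R]_d) :
    set 'cV[R]_d :=
  [set x | exists w : 'I_n -> R,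
    [/\ forall i, 0 <= w i, \sum_i w i = 1 & x = \sum_i w i *: p i]].

Definition polytope (R : realType) (d : nat) (P : set 'cV[R]_d) : Prop :=
  exists (n : nat) (p : 'I_n -> 'cV[R]_d), P = conv_hull p.

(* The vertices of a polytope are its extreme points. *)
Definition vertex (R : realType) (d : nat) (P : set 'cV[R]_d) (x : 'cV[R]_d) :
    Prop :=
  P x /\ forall (a b : 'cV[R]_d) (s : R), P a -> P b -> 0 < s < 1 ->
    x = (1 - s) *: a + s *: b -> a = x /\ b = x.

Definition lattice_polytope (R : realType) (d : nat) (P : set 'cV[R]_d) : Prop :=
  polytope P /\
  forall x, vertex P x -> exists z : 'cV[int]_d, x = map_mx intr z.

Definition polar_dual (R : realType) (d : nat) (P : set 'cV[R]_d) :
    set 'rV[R]_d :=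
  [set v | forall x, P x -> - 1 <= pairing v x].

(* [counting] takes the value +oo on infinite sets, so no value is lost by
   the totality of the cardinality function. *)
Definition ehrhart (R : realType) (d : nat) (Q : set 'rV[R]_d) (m : nat) :
    \bar R :=
  counting [set v : 'rV[int]_d |
    [set m%:R *: q | q in Q] (map_mx intr v)].

(* A series of nonnegative terms when 0 <= t, with values in [0, +oo]. *)
Definition ehrhart_series (R : realType) (d : nat) (Q : set 'rV[R]_d) (t : R) :
    \bar R :=
  (1 + \sum_(1 <= m <oo) ehrhart Q m * (t ^+ m)%:E)%E.

(* On a nonempty compact set, such as a polytope with an interior point, the
   infimum is a minimum. *)
Definition hfun (R : realType) (d : nat) (P : set 'cV[R]_d) (v : 'rV[R]_d) : R :=
  - inf [set pairing v x | x in P].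

(* The terms are nonnegative when y0 and the y i are positive (for instance
   y i = y0 `^ z i), so that the unordered sum over the dual lattice is [esum],
   with values in [0, +oo]; it converges iff it is a [fin_num].  The exponent
   of y0 is real, hence [powR]; those of the y i are integers. *)
Definition dual_lattice_fun (R : realType) (d : nat) (P : set 'cV[R]_d)
    (y0 : R) (y : 'I_d -> R) : \bar R :=
  \esum_(v in [set: 'rV[int]_d])
    (y0 `^ (- hfun P (map_mx intr v)) * \prod_(i < d) y i ^ (- v 0 i))%:E.

(* Main.v *)
Require Import Defs.
From HB Require Import structures.
From mathcomp Require Import all_boot all_order all_algebra finmap.
From mathcomp Require Import all_classical all_reals all_analysis.
Import Order.TTheory GRing.Theory Num.Theory.
Import numFieldNormedType.Exports.
Local Open Scope classical_set_scope.
Local Open Scope ring_scope.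

(** For m >= 1 a functional v lies in m P^\vee exactly when v >= -m on P, that
    is, when h_P(v) <= m; so L(P^\vee; m) counts the lattice functionals in a
    sublevel set of h_P ([ehrhart_polar]).  When P is a lattice polytope,
    min_P v is attained at a vertex, which is an integer point, so h_P takes
    integer values on the dual lattice, and they are nonnegative as 0 is in P
    ([lattice_hfun_nat]).  When 0 is interior to P, the only functional with
    h_P(v) <= 0 is v = 0, which accounts for the constant term 1 of the series.
    Hence, exchanging two sums of nonnegative terms ([layer_cake_geometric]),

      E(P^\vee; t) = \sum_m \sum_(v | h_P(v) <= m) t^m
                   = \sum_v \sum_(m >= h_P(v)) t^m
                   = \sum_v t^(h_P(v)) / (1 - t),

    and the terms of K_P(1/t; 1, ..., 1) are (1/t)^(- h_P(v)) = t^(h_P(v)).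

    The identity so far holds in [0, +oo].  Finiteness comes from the interior
    point again: P contains a small cube around 0, so h_P(v) >= c |v|_1 for
    some c > 0 ([hfun_ge_norm1]), and the sum over v is dominated by a product
    of d convergent two-sided geometric series ([esum_lattice_geometric]).

    That a linear form on a polytope attains its minimum at an extreme point
    is obtained by choosing, among the points that generate the polytope, a
    minimal generating subfamily: its members are extreme
    ([minimal_generators_are_vertices]). *)

(** * Unordered sums and counting *)

Lemma counting_esum {R : realType} {T : choiceType} (A : set T) :
  counting A = \esum_(x in A) 1%E :> \bar R.
Proof.
rewrite /counting; case: asboolP => [finA|infA].
  rewrite esum_fset// fsbig_finite//= sumEFin.
  by rewrite big_const_seq count_predT iter_addr_0.
apply/esym/eq_infty => r.
have [B BA cardB] := infinite_set_fset (Num.truncn r).+1 infA.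
apply: (@esum_ge R T); exists [set` B]; first by split.
rewrite fsbig_finite// set_fsetK sumEFin big_const_seq count_predT iter_addr_0.
by rewrite lee_fin (le_trans (ltW (truncnS_gt r)))// ler_nat.
Qed.

Lemma esumZl {R : realType} {T : choiceType} (A : set T) (c : R)
    (a : T -> \bar R) :
  0 <= c -> (forall x, 0 <= a x)%E ->
  (\esum_(x in A) (c%:E * a x) = c%:E * \esum_(x in A) a x)%E.
Proof.
move=> c0 a0; rewrite /esum -ereal_supZl//.
  rewrite image_comp; congr ereal_sup; apply: eq_imagel => X _ /=.
  by rewrite ge0_mule_fsumr.
apply/set0P; exists 0%E, set0; first exact: fsets_set0.
by rewrite fsbig_set0.
Qed.

Lemma nneseries_geometric_tail {R : realType} (t : R) (h : nat) : 0 <= t < 1 ->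
  (\sum_(m <oo) (if (h <= m)%N then t ^+ m else 0)%:E
   = (1 / (1 - t) * t ^+ h)%:E)%E.
Proof.
move=> /andP[t0 t1].
rewrite (nneseries_split 0 h); last first.
  by move=> k _; rewrite lee_fin; case: ifP => // _; rewrite exprn_ge0.
rewrite add0n big_nat big1 ?add0e; last first.
  by move=> i /andP[_ ih]; rewrite leqNgt ih.
rewrite -nneseries_addn; last first.
  by move=> k; rewrite lee_fin; case: ifP => // _; rewrite exprn_ge0.
under eq_eseriesr do rewrite leq_addl.
have partialE n : (\sum_(0 <= i < n) (t ^+ (i + h))%:E =
    (series (geometric (t ^+ h) t) n)%:E)%E.
  by rewrite sumEFin; congr EFin; apply: eq_bigr => i _; rewrite addnC exprD.
rewrite (funext partialE).
apply/cvg_lim => //; apply: cvg_EFin; first exact: nearW.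
rewrite mul1r mulrC.
by apply: cvg_geometric_series; rewrite ger0_norm.
Qed.

(** Both sides are the sum of t^m over all pairs (v, m) with H v <= m, summed
    in the two possible orders. *)
Lemma layer_cake_geometric {R : realType} {T : choiceType} (H : T -> nat)
    (t : R) :
  0 <= t < 1 ->
  (\sum_(m <oo) counting [set v | (H v <= m)%N] * (t ^+ m)%:E
   = (1 / (1 - t))%:E * \esum_(v in [set: T]) (t ^+ H v)%:E)%E.
Proof.
move=> /[dup] t01 /andP[t0 t1].
pose F m v := (if (H v <= m)%N then t ^+ m else 0)%:E.
have F0 m v : (0 <= F m v)%E.
  by rewrite lee_fin; case: ifP => // _; rewrite exprn_ge0.
have termE m :
    (counting [set v | (H v <= m)%N] * (t ^+ m)%:E =
     \esum_(v in [set: T]) F m v)%E.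
  rewrite counting_esum muleC -esumZl ?exprn_ge0// esum_mkcond.
  apply: eq_esum => v _; rewrite mule1 /F; have [Hm|mH] := leqP (H v) m.
    by rewrite mem_set.
  by rewrite memNset//=; apply/negP; rewrite -ltnNge.
under eq_eseriesr do rewrite termE.
rewrite nneseries_esumT; last by move=> m; apply: esum_ge0.
rewrite (@esum_esum _ _ _ setT (fun=> setT) F)//.
rewrite (reindex_esum (setT `*` setT) _ (fun x : T * nat => (x.2, x.1)));
  last first.
  split; [by []| |by move=> [m v] _; exists (v, m)].
  by move=> [? ?] [? ?] _ _ /= [-> ->].
rewrite -(@esum_esum _ _ _ setT (fun=> setT) (fun v m => F m v))//.
rewrite -esumZl; last first.
- by move=> v; rewrite lee_fin exprn_ge0.
- by rewrite divr_ge0// subr_ge0 ltW.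
apply: eq_esum => v _.
by rewrite -nneseries_esumT// nneseries_geometric_tail// EFinM.
Qed.

(** A finite set of lattice points fits in a box |v_i| <= N.  Over a box the sum
    factors as the d-th power of \sum_(|k| <= N) s^|k|, and allowing both signs
    for k = 0 bounds this factor by 2 / (1 - s), independently of N. *)
Lemma esum_lattice_geometric {R : realType} {d : nat} (s : R) : 0 <= s < 1 ->
  \esum_(v in [set: 'rV[int]_d]) (\prod_i s ^+ `|v 0%R i|%N)%:E \is a fin_num.
Proof.
move=> /andP[s0 s1].
have prod0 (v : 'rV[int]_d) : 0 <= \prod_i s ^+ `|v 0%R i|%N.
  by apply: prodr_ge0 => i _; rewrite exprn_ge0.
suff ub : (\esum_(v in [set: 'rV[int]_d]) (\prod_i s ^+ `|v 0%R i|%N)%:E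
    <= ((2 / (1 - s)) ^+ d)%:E)%E.
  rewrite ge0_fin_numE; first exact: le_lt_trans ub (ltry _).
  by apply: esum_ge0 => v _; rewrite lee_fin.
apply: ge_ereal_sup => _ [X [finX _] <-].
rewrite fsbig_finite// sumEFin lee_fin.
pose N := \max_(v <- fset_set X) \max_i `|v 0%R i|%N.
have leN v i : v \in fset_set X -> (`|v 0%R i|%N <= N)%N.
  move=> vX; apply: (@leq_trans (\max_i `|v 0%R i|%N)).
    exact: (leq_bigmax (F := fun i => `|v 0%R i|%N)).
  exact: (@leq_bigmax_seq _ _ _ (fun u : 'rV[int]_d => \max_i `|u 0%R i|%N)).
(* A point of the box is encoded by the signs and absolute values of its
   coordinates. *)
pose enc (v : 'rV[int]_d) :=
  [ffun i : 'I_d => (v 0 i < 0, inord `|v 0%R i|%N : 'I_N.+1)].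
have encK v i : v \in fset_set X -> ((enc v i).2 = `|v 0%R i|%N :> nat).
  by move=> vX; rewrite ffunE/= inordK// ltnS leN.
have enc_inj : {in fset_set X &, injective enc}.
  move=> u v uX vX /ffunP uv; apply/rowP => i.
  have := congr1 fst (uv i); have := congr1 (val \o snd) (uv i).
  rewrite /= encK// encK// !ffunE/= => abs sgn.
  by rewrite [LHS]intEsign [RHS]intEsign abs sgn.
pose f (g : {ffun 'I_d -> bool * 'I_N.+1}) := \prod_i s ^+ (g i).2.
have f0 g : 0 <= f g by apply: prodr_ge0 => i _; rewrite exprn_ge0.
have -> : \sum_(v <- fset_set X) \prod_i s ^+ `|v 0%R i|%N =
    \sum_(g <- map enc (fset_set X)) f g.
  rewrite big_map; apply: eq_big_seq => v vX.
  by apply: eq_bigr => i _; rewrite encK.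
rewrite big_uniq ?map_inj_in_uniq ?fset_uniq//=.
apply: (@le_trans _ _ (\sum_g f g)).
  by rewrite [leRHS](bigID (mem (map enc (fset_set X))))/= lerDl sumr_ge0.
rewrite -(bigA_distr_bigA (fun _ => fun k : bool * 'I_N.+1 => s ^+ k.2))/=.
rewrite prodr_const card_ord lerXn2r// ?nnegrE.
- by apply: sumr_ge0 => k _; rewrite exprn_ge0.
- by rewrite divr_ge0// subr_ge0 ltW.
rewrite -(pair_bigA _ (fun (b : bool) (k : 'I_N.+1) => s ^+ k))/=.
rewrite sumr_const card_bool -[leLHS]mulr_natl ler_wpM2l//.
rewrite -[leRHS]div1r ler_pdivlMr ?subr_gt0// mulrC -opprB mulNr -subrX1 opprB.
by rewrite gerBl exprn_ge0.
Qed.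

(** * Vertices of polytopes *)

Lemma pairing_sumZ {R : realType} {d : nat} {I : finType} (v : 'rV[R]_d)
  (w : I -> R) (p : I -> 'cV[R]_d) :
  pairing v (\sum_i w i *: p i) = \sum_i w i * pairing v (p i).
Proof.
rewrite /pairing mulmx_sumr summxE; apply: eq_bigr => i _.
by rewrite -scalemxAr mxE.
Qed.

(** The weights are indexed by all of 'I_n, and vanish off A, so that
    combinations over different subfamilies can be added and compared without
    reindexing. *)
Definition conv_on {R : realType} {d n : nat} (p : 'I_n -> 'cV[R]_d)
    (A : {set 'I_n}) : set 'cV[R]_d :=
  [set x | exists w : 'I_n -> R,
    [/\ forall i, 0 <= w i, \sum_i w i = 1,
       (forall i, i \notin A -> w i = 0) & x = \sum_i w i *: p i]].

Lemma conv_on_setT {R : realType} {d n : nat} (p : 'I_n -> 'cV[R]_d) :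
  conv_hull p = conv_on p [set: 'I_n]%SET.
Proof.
apply/seteqP; split=> x [w].
  by case=> w0 w1 ->; exists w; split=> // i; rewrite inE.
by case=> w0 w1 _ ->; exists w.
Qed.

(** If p i is a combination of the generators in A giving p i itself a weight
    g i < 1, solving for p i writes it with weights g j / (1 - g i) on the other
    generators only; substituting this makes p i redundant. *)
Lemma conv_on_setD1 {R : realType} {d n : nat} (p : 'I_n -> 'cV[R]_d)
    (A : {set 'I_n}) (i : 'I_n) (g : 'I_n -> R) :
  i \in A -> (forall j, 0 <= g j) -> \sum_j g j = 1 ->
  (forall j, j \notin A -> g j = 0) -> g i != 1 ->
  p i = \sum_j g j *: p j ->
  conv_on p A `<=` conv_on p (A :\ i)%SET.
Proof.
move=> iA g0 g1 gA gi1 pi x [w [w0 w1 wA ->]].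
have Dsum (f : 'I_n -> R) : \sum_j f j = f i + \sum_(j | j != i) f j.
  by rewrite (bigD1 i).
have gi : 0 < 1 - g i.
  by rewrite subr_gt0 lt_neqAle gi1/= -g1 Dsum lerDl sumr_ge0.
pose u j := if j == i then 0 else w j + w i * (g j / (1 - g i)).
exists u; split.
- move=> j; rewrite /u; case: ifP => // _.
  by rewrite addr_ge0// mulr_ge0// divr_ge0// ltW.
- rewrite Dsum {1}/u eqxx add0r.
  have -> : \sum_(j | j != i) u j =
      \sum_(j | j != i) (w j + w i * (g j / (1 - g i))).
    by apply: eq_bigr => j /negPf ji; rewrite /u ji.
  rewrite big_split/= -mulr_sumr -mulr_suml.
  have -> : \sum_(j | j != i) g j = 1 - g i.
    by rewrite -g1 (Dsum g) addrAC subrr add0r.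
  by rewrite divff ?gt_eqF// mulr1 addrC -Dsum.
- move=> j; rewrite in_setD1 negb_and negbK /u; case: eqP => //= _ jA.
  by rewrite wA// gA// mul0r mulr0 addr0.
have pi' : p i = \sum_(j | j != i) (g j / (1 - g i)) *: p j.
  apply: (scalerI (a := 1 - g i)); first by rewrite gt_eqF.
  rewrite scalerBl scale1r {1}pi (bigD1 i)//= addrAC subrr add0r scaler_sumr.
  by apply: eq_bigr => j _; rewrite scalerA mulrC divfK ?gt_eqF.
rewrite (bigD1 i)//= [RHS](bigD1 i)//= /u eqxx scale0r add0r.
rewrite {1}pi' scaler_sumr -big_split/=; apply: eq_bigr => j /negPf ->.
by rewrite scalerA -scalerDl addrC.
Qed.

(** Take A minimal among the subfamilies with the same hull.  By minimality
    every way of writing p i, for i in A, as a combination over A gives weight 1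
    to p i.  If p i = (1 - s) a + s b, the weights of p i in a and in b average
    to 1, hence are both 1, and a = b = p i. *)
Lemma minimal_generators_are_vertices {R : realType} {d n : nat}
    (p : 'I_n -> 'cV[R]_d) :
  exists A : {set 'I_n}, conv_hull p = conv_on p A /\
    forall i, i \in A -> vertex (conv_hull p) (p i).
Proof.
have [A /minsetP[/asboolP genA minA] _] :=
  @minset_exists 'I_n (fun A => `[< conv_hull p = conv_on p A >]) [set: 'I_n]%SET
    (introT (asboolP _) (conv_on_setT p)).
exists A; split=> // i iA.
(* Otherwise i could be removed from A. *)
have pure g : (forall j, 0 <= g j) -> \sum_j g j = 1 ->
    (forall j, j \notin A -> g j = 0) -> p i = \sum_j g j *: p j -> g i = 1.
  move=> g0 g1 gA pi; apply/eqP; apply: contraT => gi1.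
  suff /minA/(_ (subD1set _ _))/setP/(_ i) :
      `[< conv_hull p = conv_on p (A :\ i)%SET >].
    by rewrite !inE eqxx iA.
  apply/asboolP; rewrite genA; apply/seteqP; split.
    exact: (conv_on_setD1 _ _ _ g iA g0 g1 gA gi1 pi).
  move=> x [w [w0 w1 wA ->]]; exists w; split=> // j jA; apply: wA.
  by rewrite in_setD1 negb_and jA orbT.
split.
  rewrite conv_on_setT; exists (fun j => (j == i)%:R); split.
  - by move=> j; rewrite ler0n.
  - rewrite -[RHS](big_pred1_eq +%R i (fun=> 1)) [RHS]big_mkcond.
    by apply: eq_bigr => j _; case: eqP.
  - by move=> j; rewrite inE.
  rewrite (bigD1 i)//= eqxx scale1r big1 ?addr0// => j /negPf ->; exact: scale0r.
move=> a b s; rewrite genA => -[wa [wa0 wa1 waA ->]] [wb [wb0 wb1 wbA ->]].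
move=> /andP[s0 s1] pi.
have s1' : 0 < 1 - s by rewrite subr_gt0.
have le1 w : (forall j, 0 <= w j) -> \sum_j w j = 1 -> w i <= 1.
  by move=> w0 <-; rewrite (bigD1 i)//= lerDl sumr_ge0.
have gi1 : (1 - s) * wa i + s * wb i = 1.
  apply: (pure (fun j => (1 - s) * wa j + s * wb j)).
  - by move=> j; rewrite addr_ge0// mulr_ge0// ltW.
  - by rewrite big_split/= -!mulr_sumr wa1 wb1 !mulr1 subrK.
  - by move=> j jA; rewrite waA// wbA// !mulr0 addr0.
  rewrite pi !scaler_sumr -big_split/=; apply: eq_bigr => j _.
  by rewrite !scalerA scalerDl.
have [/eqP wai /eqP wbi] : wa i == 1 /\ wb i == 1.
  have /eqP : (1 - s) * (1 - wa i) + s * (1 - wb i) = 0.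
    by rewrite !mulrBr !mulr1 addrACA -opprD gi1 subrK subrr.
  rewrite paddr_eq0; first last.
  - by rewrite mulr_ge0 ?(ltW s0)// subr_ge0 le1.
  - by rewrite mulr_ge0 ?(ltW s1')// subr_ge0 le1.
  rewrite !mulf_eq0 (gt_eqF s0) (gt_eqF s1')/= !subr_eq0.
  by rewrite ![1 == _]eq_sym => /andP[].
have dirac w : (forall j, 0 <= w j) -> \sum_j w j = 1 -> w i = 1 ->
    \sum_j w j *: p j = p i.
  move=> w0 w1 wi; rewrite (bigD1 i)//= wi scale1r big1 ?addr0// => j ji.
  suff -> : w j = 0 by rewrite scale0r.
  have /eqP : \sum_(j | j != i) w j = 0.
    by apply: (addrI (w i)); rewrite addr0 {2}wi -w1 [in RHS](bigD1 i).
  rewrite psumr_eq0// => /allP/(_ j); rewrite mem_index_enum ji/=.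
  by move=> /(_ isT)/eqP.
by rewrite !dirac.
Qed.

Lemma polytope_min_at_vertex {R : realType} {d : nat} (P : set 'cV[R]_d)
    (v : 'rV[R]_d) : polytope P -> P !=set0 ->
  exists2 x, vertex P x & forall y, P y -> pairing v x <= pairing v y.
Proof.
move=> [n [p ->]] [x0 Px0].
have [A [genA vertA]] := minimal_generators_are_vertices p.
have [i0 i0A] : exists i, i \in A.
  move: Px0; rewrite genA => -[w [w0 w1 wA _]].
  apply/set0Pn; apply: contraT; rewrite negbK => /eqP A0.
  suff : 1 = 0 :> R by move/eqP; rewrite oner_eq0.
  by rewrite -w1 big1// => i _; rewrite wA// A0 inE.
have [i iA imin] := arg_minP (fun i => pairing v (p i)) i0A.
exists (p i) => [|y]; first exact: vertA.
rewrite genA => -[w [w0 w1 wA ->]].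
rewrite pairing_sumZ -[leLHS]mul1r -w1 mulr_suml; apply: ler_sum => j _.
have [jA|jA] := boolP (j \in A); first by rewrite ler_wpM2l// imin.
by rewrite wA// !mul0r.
Qed.

(** * The support function *)

Lemma hfun_min {R : realType} {d : nat} (P : set 'cV[R]_d) (v : 'rV[R]_d) x :
  P x -> (forall y, P y -> pairing v x <= pairing v y) ->
  hfun P v = - pairing v x.
Proof.
move=> Px xmin; congr (- _); apply/eqP; rewrite eq_le; apply/andP; split.
  apply: ge_inf; last by exists x.
  by exists (pairing v x) => _ [y Py <-]; exact: xmin.
apply: lb_le_inf; first by exists (pairing v x), x.
by move=> _ [y Py <-]; exact: xmin.
Qed.

Lemma polytope_hfun_leP {R : realType} {d : nat} (P : set 'cV[R]_d)
    (v : 'rV[R]_d) (c : R) : polytope P -> P !=set0 ->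
  hfun P v <= c <-> forall x, P x -> - c <= pairing v x.
Proof.
move=> polyP P0; have [x [Px _] xmin] := polytope_min_at_vertex P v polyP P0.
rewrite (hfun_min P v x)// lerNl; split=> [cx y Py|]; last exact.
exact: le_trans cx (xmin y Py).
Qed.

(** The minimum of v over P is the value of v at an integer point. *)
Lemma lattice_hfun_nat {R : realType} {d : nat} (P : set 'cV[R]_d)
    (v : 'rV[int]_d) : lattice_polytope P -> P 0 ->
  exists n : nat, hfun P (map_mx intr v) = n%:R.
Proof.
move=> [polyP latP] P0.
have [x vx xmin] :=
  polytope_min_at_vertex P (map_mx intr v) polyP (ex_intro _ _ P0).
have [z xz] := latP _ vx.
have hE := hfun_min P _ x vx.1 xmin.
have h0 : 0 <= hfun P (map_mx intr v).
  by rewrite hE oppr_ge0 (le_trans (xmin _ P0))// /pairing mulmx0 mxE.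
move: hE h0; rewrite xz /pairing -map_mxM mxE -mulrNz => ->.
by rewrite ler0z => /gez0_abs <-; exists `|(- (v *m z) 0 0)%R|%N.
Qed.

(** A cube [- c, c]^d inside P contains the point with coordinates
    - c sg(v_i), where v takes the value - c |v|_1. *)
Lemma hfun_ge_norm1 {R : realType} {d : nat} (P : set 'cV[R]_d) :
  polytope P -> P° 0 ->
  exists2 c : R, 0 < c & forall v : 'rV[R]_d, c * \sum_i `|v 0 i| <= hfun P v.
Proof.
move=> polyP /nbhs_ballP[e /= e0 eP]; exists (e / 2); first by rewrite divr_gt0.
move=> v.
pose x : 'cV[R]_d := \col_i (- (e / 2 * Num.sg (v 0 i))).
have Px : P x.
  apply: eP; split=> // i j; rewrite !mxE -ball_normE/= sub0r opprK normrM.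
  rewrite ger0_norm ?divr_ge0 ?ltW//.
  apply: (@le_lt_trans _ _ (e / 2)); last by rewrite gtr_pMr// invf_lt1 ?ltr1n.
  by rewrite ler_piMr//; [rewrite ltW// divr_gt0|rewrite normr_sg lern1 leq_b1].
have := (polytope_hfun_leP P v _ polyP (ex_intro _ _ Px)).1 (lexx _) _ Px.
rewrite lerNl; suff -> : e / 2 * \sum_i `|v 0 i| = - pairing v x by [].
rewrite /pairing mxE -sumrN mulr_sumr; apply: eq_bigr => i _.
by rewrite !mxE mulrN opprK normrEsg mulrA mulrC.
Qed.

Lemma hfun_eq0 {R : realType} {d : nat} (P : set 'cV[R]_d) (v : 'rV[int]_d) :
  polytope P -> P° 0 -> hfun P (map_mx intr v) <= 0 -> v = 0.
Proof.
move=> polyP P0 h0; have [c c0 hc] := hfun_ge_norm1 P polyP P0.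
have := le_trans (hc _) h0.
rewrite pmulr_rle0// => le0; apply/rowP => i; rewrite mxE; apply/eqP.
have : `|(map_mx intr v : 'rV[R]_d) 0 i| <= 0.
  by apply: le_trans le0; rewrite (bigD1 i)//= lerDl sumr_ge0.
by rewrite normr_le0 mxE intr_eq0.
Qed.

Lemma ehrhart_polar {R : realType} {d : nat} (P : set 'cV[R]_d) (m : nat) :
  polytope P -> P !=set0 -> (0 < m)%N ->
  ehrhart (polar_dual P) m =
  counting [set v : 'rV[int]_d | hfun P (map_mx intr v) <= m%:R].
Proof.
move=> polyP P0 m0; rewrite /ehrhart; congr counting; apply/seteqP.
have m0' : 0 < m%:R :> R by rewrite ltr0n.
split=> v /=.
  move=> [q Pq <-]; apply/polytope_hfun_leP => // x /Pq q1.
  by rewrite /pairing -scalemxAl mxE -[leLHS]mulrN1 ler_pM2l.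
move=> /polytope_hfun_leP H; exists (m%:R^-1 *: map_mx intr v); last first.
  by rewrite scalerA divff ?gt_eqF// scale1r.
move=> x /(H polyP P0) Hx; rewrite /pairing -scalemxAl mxE.
by rewrite ler_pdivlMl// mulrN1.
Qed.

(** * The dual lattice function at y = 1 *)

Lemma dual_lattice_fun_at1 {R : realType} {d : nat} (P : set 'cV[R]_d) (t : R) :
  0 <= t ->
  dual_lattice_fun P (1 / t) (fun=> 1) =
  \esum_(v in [set: 'rV[int]_d]) (t `^ hfun P (map_mx intr v))%:E.
Proof.
move=> t0; apply: eq_esum => v _; congr EFin.
rewrite big1 ?mulr1; last by move=> i _; exact: exp1rz.
by rewrite div1r -powR_inv1// -powRrM mulN1r opprK.
Qed.

(** With s = t^c, the bound h_P(v) >= c |v|_1 gives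
    t^(h_P(v)) <= \prod_i s^|v_i|. *)
Lemma esum_powR_hfun_fin_num {R : realType} {d : nat} (P : set 'cV[R]_d) (t : R) :
  polytope P -> P° 0 -> 0 < t < 1 ->
  \esum_(v in [set: 'rV[int]_d]) (t `^ hfun P (map_mx intr v))%:E
    \is a fin_num.
Proof.
move=> polyP P0 /andP[t0 t1].
have [c c0 hc] := hfun_ge_norm1 P polyP P0.
have s01 : 0 <= t `^ c < 1.
  by rewrite powR_ge0/= /powR gt_eqF// expR_lt1 pmulr_rlt0// ln_lt0// t0.
have fin := esum_lattice_geometric (d := d) _ s01.
rewrite ge0_fin_numE; last by apply: esum_ge0 => v _; rewrite lee_fin powR_ge0.
apply: (@le_lt_trans _ _ (\esum_(v in [set: 'rV[int]_d])
    (\prod_i (t `^ c) ^+ `|v 0%R i|%N)%:E)%E); last by rewrite ltey_eq fin.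
apply: le_esum => v _; rewrite lee_fin.
have powD : {morph powR t : x y / x + y >-> x * y}.
  by move=> x y; apply: powRD; rewrite (gt_eqF t0) implybT.
have -> : \prod_i (t `^ c) ^+ `|v 0%R i|%N =
    t `^ (c * \sum_i `|(map_mx intr v : 'rV[R]_d) 0 i|).
  rewrite mulr_sumr (big_morph (powR t) powD (powRr0 t)).
  apply: eq_bigr => i _; rewrite mxE -intr_norm -natr_absz powRrM.
  by rewrite powR_mulrn// powR_ge0.
have t01 : 0 < t <= 1 by rewrite t0 (ltW t1).
by apply: (ger_powR t01); exact: hc.
Qed.

(** * The Ehrhart series of the polar dual *)

Theorem proposition3p18 (R : realType) (d : nat) (P : set 'cV[R]_d)
    (latP : lattice_polytope P) (P0 : P° 0) (t : R) (t01 : 0 < t < 1) :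
  dual_lattice_fun P (1 / t) (fun=> 1) \is a fin_num /\
  ehrhart_series (polar_dual P) t =
    ((1 / (1 - t))%:E * dual_lattice_fun P (1 / t)%R (fun=> 1%R))%E.
Proof.
have /andP[/ltW t0 t1] := t01; have [polyP _] := latP.
have P0' : P 0 by exact: interior_subset P0.
rewrite !dual_lattice_fun_at1//; split; first exact: esum_powR_hfun_fin_num.
have [H hH] := choice (fun v => lattice_hfun_nat P v latP P0').
under eq_esum do rewrite hH powR_mulrn//.
rewrite -layer_cake_geometric ?t0// /ehrhart_series.
rewrite nneseries_recl//; last first.
  move=> m _; rewrite mule_ge0 ?lee_fin ?exprn_ge0// counting_esum.
  exact: esum_ge0.
congr (_ + _)%E.
  rewrite expr0 mule1.
  have -> : [set v | (H v <= 0)%N] = [set 0 : 'rV[int]_d].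
    apply/seteqP; split=> v /=.
      rewrite leqn0 => /eqP Hv; apply: (hfun_eq0 P _ polyP P0).
      by rewrite hH Hv.
    move=> ->; rewrite -(ler_nat R) -hH map_mx0.
    apply: (polytope_hfun_leP P 0 0 polyP (ex_intro _ _ P0')).2 => x _.
    by rewrite /pairing mul0mx mxE oppr0.
  by rewrite counting_esum esum_set1.
rewrite eseries_cond [RHS]eseries_cond; apply: eq_eseriesr => m /andP[_ m0].
rewrite (ehrhart_polar P m polyP (ex_intro _ _ P0') m0).
by congr (counting _ * _)%E; apply/seteqP; split=> v /=; rewrite hH ler_nat.
Qed.
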